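(* Let $\mathcal{A}$ be a hyperplane arrangement in $\mathbb{P}^3(\mathbb{R})$ consisting of $n$ hyperplanes. Write $h:=\sum_{i \geq 2} (i-1) h^\mathcal{A}_i$ and $g^\mathcal{A}_1:=\sum_{i \geq 2} h^\mathcal{A}_i$. Then: (i) The characteristic polynomial of $\mathcal{A}$ is $$\chi(\mathcal{A},t)=(t-1)\left( t^3+(1-n)t^2+(h+1-n)t+ h + 1 -f^\mathcal{A}_3 \right).$$ (ii) All roots of $\chi(\mathcal{A},t)$ are real if and only if the following three relations hold: $$h=\sum_{i \geq 2} (i-1) h^\mathcal{A}_i= \sum_{H \in \mathcal{A}} |\mathcal{A}^H| -g^\mathcal{A}_1\leq \left \lfloor \frac{(n+2)(n-1)}{3} \right \rfloor , \tag{1}$$ $$f^\mathcal{A}_3 \leq \left \lfloor\frac{(9n+18)h + 20 + 12n + 2 \sqrt{(n^2+n-2-3h )^3}-2n^3-3n^2 }{27} \right \rfloor, \tag{2}$$ $$f^\mathcal{A}_3 \geq \left \lceil \frac{(9n+18)h + 20 + 12n - 2 \sqrt{(n^2+n-2-3h )^3}-2n^3-3n^2 }{27} \right \rceil. \tag{3}$$ Moreover, the estimates (1), (2), (3) are tight: there exists an arrangement in $\mathbb{P}^3(\mathbb{R})$ for which equality holds in each of (1), (2) and (3).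
   Context: An arrangement in $\mathbb{P}^3=\mathbb{P}^3(\mathbb{R})$ is a finite set $\mathcal{A}$ of projective hyperplanes (images of linear hyperplanes of $\mathbb{R}^4$) with empty common intersection; $n=|\mathcal{A}|$. $\mathcal{A}$ induces a cell decomposition of $\mathbb{P}^3$; $f^\mathcal{A}_i$ is the number of its $i$-dimensional cells, so $f^\mathcal{A}_3$ is the number of chambers. The intersection lattice $L$ consists of all subspaces of $\mathbb{R}^4$ that are intersections of the corresponding linear hyperplanes, ordered by reverse inclusion, with Möbius function $\mu$; the characteristic polynomial is $\chi(\mathcal{A},t)=\sum_{X\in L}\mu(\mathbb{R}^4,X)t^{\dim X}$. A line of $\mathcal{A}$ is an element of $L$ of dimension $2$; its weight is the number of hyperplanes of $\mathcal{A}$ containing it, and $h^\mathcal{A}_i$ denotes the number of lines of weight $i$ ($i\ge 2$). For $H\in\mathcal{A}$, the restriction $\mathcal{A}^H$ is the arrangement in $\mathbb{P}^2$ formed by the codimension-two elements of $L$ contained in $H$, and $|\mathcal{A}^H|$ is its number of lines. *)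

(* Defs.v *)
From HB Require Import structures.
From mathcomp Require Import all_boot all_order all_algebra all_field.
From mathcomp Require Import finmap.
From mathcomp Require Import all_classical all_reals all_analysis.
Set Implicit Arguments. Unset Strict Implicit. Unset Printing Implicit Defensive.
Import Order.TTheory GRing.Theory Num.Theory.
Import numFieldNormedType.Exports.
Local Open Scope ring_scope.

Section Arrangements.
Variable R : realType.
Variable n : nat.
(* An arrangement in P^3(R) is given by a matrix A whose i-th row is a linear
   form alpha_i on R^4 (vectors of R^4 are row vectors 'rV[R]_4); the i-th
   linear hyperplane is H_i = {x | x *m (alpha_i)^T = 0}. *)
Variable A : 'M[R]_(n, 4).

(* The hyperplanes are genuine (nonzero forms), pairwise distinct, and have
   empty common intersection in P^3, i.e. zero common intersection in R^4. *)
Definition is_arrangement : Prop :=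
  [/\ (forall i : 'I_n, row i A != 0),
      (forall i j : 'I_n, i != j -> (<<row i A>> != <<row j A>>)%MS)
    & \rank A = 4%N].

Definition formsOf (S : {set 'I_n}) : 'M[R]_(n, 4) :=
  \matrix_(i < n) (if i \in S then row i A else 0).

(* The subspace  X_S = \bigcap_{i in S} H_i  of R^4, in canonical form
   (row space of a square matrix, normalized by genmx). *)
Definition flat (S : {set 'I_n}) : 'M[R]_4 := <<kermx (formsOf S)^T>>%MS.

Definition hyp (i : 'I_n) : 'M[R]_4 := flat [set i].

Definition fullspace : 'M[R]_4 := <<1%:M>>%MS.

(* The intersection lattice L (as a duplicate-free list of subspaces);
   its order is reverse inclusion: X <=_L Y iff (Y <= X)%MS. *)
Definition Lat : seq 'M[R]_4 := undup [seq flat T | T : {set 'I_n}].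

Definition dimX (X : 'M[R]_4) : nat := \rank X.

(* Moebius function mu(R^4, X) on L, by its defining recursion
   mu(V,V) = 1,  mu(V,X) = - sum_{V <=_L Y <_L X} mu(V,Y);
   Y <_L X means X is a proper subspace of Y.  The fuel argument bounds
   the length of chains (at most 5 elements in L). *)
Fixpoint mob_rec (k : nat) (X : 'M[R]_4) : int :=
  match k with
  | 0 => 0
  | k'.+1 => if X == fullspace then 1
             else - \sum_(Y <- Lat | (X < Y)%MS) mob_rec k' Y
  end.

Definition mobius (X : 'M[R]_4) : int := mob_rec 5 X.

Definition charpoly : {poly int} :=
  \sum_(X <- Lat) (mobius X)%:P * 'X^(dimX X).

Definition lines : seq 'M[R]_4 := [seq X <- Lat | dimX X == 2%N].

Definition weight (X : 'M[R]_4) : nat := #|[set i : 'I_n | (X <= hyp i)%MS]|.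

Definition hcount (k : nat) : nat := count (fun X => weight X == k) lines.

(* h = sum_{i >= 2} (i-1) h_i  (weights never exceed n) *)
Definition hsum : nat := \sum_(2 <= k < n.+1) (k.-1 * hcount k)%N.

Definition g1 : nat := \sum_(2 <= k < n.+1) hcount k.

Definition restr_size (i : 'I_n) : nat := count (fun X => (X <= hyp i)%MS) lines.

Definition complement : set 'rV[R]_4 :=
  (fun x => forall i : 'I_n, x *m (row i A)^T != 0).

Definition central_chambers : set (set 'rV[R]_4) :=
  ((connected_component complement) @` complement)%classic.

(* f_3^A : chambers of the projective arrangement; each one lifts to exactly
   two (antipodal) chambers of the central arrangement in R^4. *)
Definition f3 : nat := (#|` fset_set central_chambers|%fset %/ 2)%N.

End Arrangements.

(* Main.v *)
Require Import Defs.
From HB Require Import structures.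
From mathcomp Require Import all_boot all_order all_algebra all_field.
From mathcomp Require Import finmap.
From mathcomp Require Import all_classical all_reals all_analysis.
(* Importing finset again gives its names precedence over those of classical_sets. *)
From mathcomp Require Import fintype finset ring lra zify.
Import Order.TTheory GRing.Theory Num.Theory.
Import numFieldNormedType.Exports.
Set Implicit Arguments. Unset Strict Implicit. Unset Printing Implicit Defensive.
Local Open Scope ring_scope.

(** The Moebius recursion is solved by Whitney's formula
    mu(X) = sum of (-1)^|S| over the sets S of hyperplanes with intersection X,
    so chi(t) = sum_S (-1)^|S| t^(dim of the intersection of S).  Hence
    chi(1) = 0, and the coefficients of t^4, t^3, t^2 are 1, -n and h.  The
    remaining coefficient is fixed by Zaslavsky's theorem, chi(-1) = number of
    chambers of the central arrangement.  To prove it, a chamber is encoded by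
    its sign vector, and realizable sign vectors inside a subspace U are counted
    by deletion-restriction: a hyperplane H not containing U cuts exactly those
    regions of U that meet H, and each of these meets H in one region of
    U :&: H.

    For (ii), the cubic factor t^3 + a t^2 + b t + c has discriminant
    (4 D0^3 - D1^2) / 27 with D0 = a^2 - 3 b = n^2 + n - 2 - 3 h and
    D1 = 2 a^3 - 9 a b + 27 c; inequality (1) says D0 >= 0, while (2) and (3)
    say |D1| <= 2 sqrt(D0^3).  The coordinate hyperplanes
    (n = 4, h = 6, f_3 = 8, D0 = 0) give equality everywhere. *)

(** * Deletion-restriction for sign vectors *)

Section Flats.
Variables (R : realType) (n : nat) (A : 'M[R]_(n, 4)).
Implicit Types (S T D P : {set 'I_n}) (i : 'I_n).

Lemma sub_flatP m (X : 'M[R]_(m, 4)) S :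
  reflect (forall i, i \in S -> X *m (row i A)^T = 0) (X <= flat A S)%MS.
Proof.
rewrite /flat genmxE; apply: (iffP sub_kermxP) => [XS i iS | XS].
  apply/matrixP => j k; have /matrixP/(_ j i) := XS; rewrite !mxE => E.
  by rewrite -[RHS]E; apply: eq_bigr => l _; rewrite !mxE iS mxE.
apply/matrixP => j k; have [kS|kS] := boolP (k \in S).
  have /matrixP/(_ j 0) := XS k kS; rewrite !mxE => E; rewrite -[RHS]E.
  by apply: eq_bigr => l _; rewrite !mxE kS mxE.
by rewrite !mxE big1 // => l _; rewrite !mxE (negPf kS) mxE mulr0.
Qed.

Lemma sub_hypP m (X : 'M[R]_(m, 4)) i :
  reflect (X *m (row i A)^T = 0) (X <= hyp A i)%MS.
Proof.
apply: (iffP (sub_flatP _ _)) => [|H j]; first by apply; rewrite inE.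
by rewrite inE => /eqP->.
Qed.

Lemma sub_flat_hyp m (X : 'M[R]_(m, 4)) S :
  (X <= flat A S)%MS = (S \subset [set i | X <= hyp A i]%MS).
Proof.
apply/sub_flatP/subsetP => H i iS.
  by rewrite inE; apply/sub_hypP/H.
by have := H i iS; rewrite inE => /sub_hypP.
Qed.

Lemma flatS S T : S \subset T -> (flat A T <= flat A S)%MS.
Proof.
move=> ST; apply/sub_flatP => i iS; move/subsetP: ST => /(_ i iS).
by move: i {iS}; apply/sub_flatP.
Qed.

Lemma genmx_flat S : <<flat A S>>%MS = flat A S.
Proof. by rewrite /flat genmx_id. Qed.

Lemma eq_flat S T : (flat A S <= flat A T)%MS -> (flat A T <= flat A S)%MS ->
  flat A S = flat A T.
Proof. by move=> st ts; rewrite -genmx_flat -[RHS]genmx_flat; apply/genmxP/andP. Qed.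

Lemma flat0 : flat A set0 = fullspace R.
Proof.
rewrite -genmx_flat; apply/genmxP/andP; split; first exact: submx1.
by apply/sub_flatP => i; rewrite inE.
Qed.

Lemma mem_Lat X : (X \in Lat A) = [exists S, X == flat A S].
Proof.
rewrite mem_undup; apply/mapP/existsP => [[S _ ->]|[S /eqP->]]; exists S => //.
by rewrite mem_enum.
Qed.

Lemma flat_in_Lat S : flat A S \in Lat A.
Proof. by rewrite mem_Lat; apply/existsP; exists S. Qed.

(** In a deletion-restriction step, the sets containing [i] become arbitrary sets for the
    restriction of [U] to [hyp A i]. *)
Lemma flatU1 (U : 'M[R]_4) i S : (U :&: flat A (i |: S) :=: U :&: hyp A i :&: flat A S)%MS.
Proof.
apply/eqmxP/andP; split.
  rewrite !sub_capmx capmxSl /=; apply/andP; split;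
    apply: submx_trans (capmxSr _ _) _; apply: flatS.
    by rewrite sub1set !inE eqxx.
  exact: subsetUr.
rewrite sub_capmx -capmxA capmxSl /= capmxA.
apply/sub_flatP => j /setU1P[->|jS].
  by apply/sub_hypP; rewrite (submx_trans (capmxSl _ _)) ?capmxSr.
by apply/sub_hypP; apply: submx_trans (capmxSr _ _) _; apply: flatS; rewrite sub1set.
Qed.

Lemma rank_flatU1 (U : 'M[R]_4) i S :
  \rank (U :&: flat A (i |: S))%MS = \rank (U :&: hyp A i :&: flat A S)%MS.
Proof. exact: (flatU1 U i S).1. Qed.

(** Rank-nullity for the [i]-th form restricted to [U]: the form is nonzero there, so its image is
    one-dimensional. *)
Lemma rank_cap_hyp (U : 'M[R]_4) i : ~~ (U <= hyp A i)%MS ->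
  \rank U = (\rank (U :&: hyp A i)%MS).+1.
Proof.
move=> Ui; rewrite -(mxrank_mul_ker U (row i A)^T).
have -> : \rank (U :&: kermx (row i A)^T)%MS = \rank (U :&: hyp A i)%MS.
  apply: eqmx_rank; apply/andP; split; apply: capmxS => //.
    by apply/sub_hypP; rewrite mulmx_ker.
  by apply/sub_kermxP/sub_hypP.
suff -> : \rank (U *m (row i A)^T) = 1%N by rewrite add1n.
apply/eqP; rewrite eqn_leq rank_leq_col lt0n mxrank_eq0.
by apply/negP => /eqP/sub_hypP; apply/negP.
Qed.

Definition form i (x : 'rV[R]_4) : R := (x *m (row i A)^T) 0 0.

Lemma form_linear i a x y : form i (a *: x + y) = a * form i x + form i y.
Proof. by rewrite /form mulmxDl -scalemxAl !mxE. Qed.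

Lemma mul_row_form i x : (x *m (row i A)^T == 0) = (form i x == 0).
Proof.
apply/eqP/eqP => [E|E]; first by rewrite /form E mxE.
by apply/matrixP => a b; rewrite !ord1 -[LHS]/(form i x) E mxE.
Qed.

Lemma sub_hyp_form i x : (x <= hyp A i)%MS = (form i x == 0).
Proof. by rewrite -mul_row_form; apply/sub_hypP/eqP. Qed.

(** A sign vector on [D] is encoded by its set [P] of positive indices; the signs outside [D] are
    left free. *)
Definition sign_on D P (x : 'rV[R]_4) : Prop :=
  forall i, i \in D -> if i \in P then 0 < form i x else form i x < 0.

Definition realizable (U : 'M[R]_4) D P : bool :=
  `[< exists2 x : 'rV[R]_4, (x <= U)%MS & sign_on D P x >].

Lemma sign_on_convex D P x y a b : 0 < a -> 0 < b ->
  sign_on D P x -> sign_on D P y -> sign_on D P (a *: x + b *: y).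
Proof.
move=> a0 b0 Hx Hy i iD; move: (Hx i iD) (Hy i iD).
rewrite form_linear -[b *: y]addr0 form_linear.
have -> : form i 0 = 0 by rewrite /form mul0mx mxE.
rewrite addr0; case: ifP => _ fx fy; first by rewrite addr_gt0 ?mulr_gt0.
by rewrite -oppr_gt0 opprD addr_gt0 // -mulrN mulr_gt0 // oppr_gt0.
Qed.

Lemma sign_on_perturb D P x u : sign_on D P x ->
  exists2 e, 0 < e & forall t, `|t| <= e -> sign_on D P (t *: u + x).
Proof.
move=> Hx.
(* [s] dominates every ratio of [form i u] to [form i x], so a displacement of size at most 1/(1+s)
   flips no sign; the 1 keeps the denominator positive. *)
set s := \sum_(i in D) `|form i u| / `|form i x|.
have s0 : 0 <= s by apply: sumr_ge0 => i _; rewrite divr_ge0.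
exists (1 + s)^-1; first by rewrite invr_gt0 ltr_wpDr.
move=> t te i iD.
have fx0 : form i x != 0.
  by have := Hx i iD; case: ifP => _ h; rewrite ?(gt_eqF h) ?(lt_eqF h).
have lt1 : `|form i u| / `|form i x| < 1 + s.
  apply: (@le_lt_trans _ _ s); last by rewrite ltrDr.
  by rewrite /s (bigD1 i) //= lerDl; apply: sumr_ge0 => j _; rewrite divr_ge0.
have : `|t * form i u| < `|form i x|.
  rewrite normrM; apply: (@le_lt_trans _ _ ((1 + s)^-1 * `|form i u|)).
    by rewrite ler_wpM2r.
  rewrite mulrC ltr_pdivrMr ?ltr_wpDr // mulrC -ltr_pdivrMr ?normr_gt0 //.
have := Hx i iD; rewrite form_linear ltr_norml.
by case: ifP => _ h; rewrite ?(gtr0_norm h) ?(ltr0_norm h) => /andP[]; lra.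
Qed.

Lemma sign_on_setU1 i D P x : i \notin D -> P \subset D ->
  sign_on (i |: D) P x <-> form i x < 0 /\ sign_on D P x.
Proof.
move=> iD PD; have iP : i \notin P by apply: contra iD; apply: (subsetP PD).
split=> [H|[fx H] j /setU1P[->|/H//]]; last by rewrite (negPf iP).
split=> [|j jD]; last by apply: H; rewrite !inE jD orbT.
by have := H i; rewrite (negPf iP) setU11; apply.
Qed.

Lemma sign_on_setU1U1 i D P x : i \notin D -> P \subset D ->
  sign_on (i |: D) (i |: P) x <-> 0 < form i x /\ sign_on D P x.
Proof.
move=> iD PD.
have E j : j \in D -> (j \in i |: P) = (j \in P).
  by move=> jD; rewrite !inE; case: eqP => // ji; rewrite ji (negPf iD) in jD.
split=> [H|[fx H] j /setU1P[->|jD]]; first split=> [|j jD].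
- by have := H i; rewrite !setU11; apply.
- by rewrite -E //; apply: H; rewrite !inE jD orbT.
- by rewrite setU11.
- by rewrite E //; apply: H.
Qed.

(** A realizable region of [U] lies on at least one side of [hyp A i] or meets it, and it has points
    on both sides exactly when it meets it. *)
Lemma realizable_split (U : 'M[R]_4) i D P : i \notin D -> P \subset D ->
  ~~ (U <= hyp A i)%MS ->
  (realizable U (i |: D) P + realizable U (i |: D) (i |: P)
   = realizable U D P + realizable (U :&: hyp A i)%MS D P)%N.
Proof.
move=> iD PD Ui.
set b1 := realizable U (i |: D) P; set b2 := realizable U (i |: D) (i |: P).
set b3 := realizable U D P; set b4 := realizable (U :&: hyp A i)%MS D P.
have neg : b1 -> exists2 x : 'rV_4, (x <= U)%MS & form i x < 0 /\ sign_on D P x.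
  by case/asboolP => x xU /sign_on_setU1 => /(_ iD PD) ?; exists x.
have pos : b2 -> exists2 x : 'rV_4, (x <= U)%MS & 0 < form i x /\ sign_on D P x.
  by case/asboolP => x xU /sign_on_setU1U1 => /(_ iD PD) ?; exists x.
have h13 : b1 -> b3 by case/neg => x xU [_ ?]; apply/asboolP; exists x.
have h23 : b2 -> b3 by case/pos => x xU [_ ?]; apply/asboolP; exists x.
have h124 : b1 -> b2 -> b4.
  case/neg=> x xU [fx Hx] /pos[y yU [fy Hy]]; apply/asboolP.
  (* Up to scaling, this is the point where the segment from [x] to [y] crosses the hyperplane; both
     coefficients are positive. *)
  exists (form i y *: x + - form i x *: y).
    rewrite sub_capmx; apply/andP; split; first by rewrite addmx_sub ?scalemx_sub.
    rewrite sub_hyp_form form_linear -[- form i x *: y]addr0 form_linear.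
    have -> : form i 0 = 0 by rewrite /form mul0mx mxE.
    by rewrite addr0 mulNr mulrC subrr.
  by apply: sign_on_convex; rewrite ?oppr_gt0.
have h4 : b4 -> b1 /\ b2.
  case/asboolP => x; rewrite sub_capmx sub_hyp_form => /andP[xU /eqP fx] Hx.
  have [u uU fu] : exists2 u : 'rV_4, (u <= U)%MS & form i u != 0.
    have /row_subPn[k Hk] := Ui; exists (row k U); first exact: row_sub.
    by rewrite -sub_hyp_form.
  have [e e0 He] := sign_on_perturb u Hx.
  (* The sign makes [t *: u] point to the positive side, so adding and subtracting it moves [x] off
     the hyperplane in both directions. *)
  pose t := e * Num.sg (form i u).
  have te : `|t| <= e by rewrite normrM normr_sg fu mulr1 gtr0_norm.
  have tu : 0 < t * form i u by rewrite -mulrA -normrEsg mulr_gt0 ?normr_gt0.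
  split; apply/asboolP.
    exists (- t *: u + x); first by rewrite addmx_sub ?scalemx_sub.
    apply/sign_on_setU1 => //; split; last by apply: He; rewrite normrN.
    by rewrite form_linear fx addr0 mulNr oppr_lt0.
  exists (t *: u + x); first by rewrite addmx_sub ?scalemx_sub.
  apply/sign_on_setU1U1 => //; split; last exact: He.
  by rewrite form_linear fx addr0.
have h3 : b3 -> [\/ b1, b2 | b4].
  case/asboolP => x xU Hx.
  have [fx|fx|fx] := ltrgtP (form i x) 0.
  - by apply: Or31; apply/asboolP; exists x => //; apply/sign_on_setU1.
  - by apply: Or32; apply/asboolP; exists x => //; apply/sign_on_setU1U1.
  - by apply: Or33; apply/asboolP; exists x => //; rewrite sub_capmx xU sub_hyp_form fx eqxx.
(* Only truth values remain: the implications exclude every assignment that violates the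
   identity. *)
move: b1 b2 b3 b4 {neg pos} h13 h23 h124 h4 h3.
case=> [] [] [] [] // h13 h23 h124 h4 h3; (try by case: (h4 isT));
  (try by move: (h13 isT)); (try by move: (h23 isT)); (try by move: (h124 isT isT)).
by case: (h3 isT).
Qed.

End Flats.

(** * Counting realizable sign vectors by alternating sums over subsets *)

Lemma sum_subsets_setU1 (V : nmodType) (T : finType) (i : T) (D : {set T})
    (F : {set T} -> V) : i \notin D ->
  \sum_(P : {set T} | P \subset i |: D) F P
  = \sum_(P : {set T} | P \subset D) (F P + F (i |: P)).
Proof.
move=> iD; rewrite (bigID (fun P : {set T} => i \in P)) /= addrC big_split /=.
congr (_ + _).
  apply: eq_bigl => P; apply/andP/idP => [[PD iP]|PD].
    by rewrite -(setU1K iD) subsetD1 PD.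
  by rewrite (contra (subsetP PD i) iD) (subset_trans PD) ?subsetUr.
rewrite (reindex_onto (fun P : {set T} => i |: P) (fun P => P :\ i)) /=; last first.
  by move=> P /andP[_ iP]; rewrite setD1K.
apply: eq_bigl => P; rewrite setU11 andbT.
apply/andP/idP => [[PD /eqP E]|PD].
  by rewrite -E -(setU1K iD) setSD.
by rewrite setUS // setU1K // (contra (subsetP PD i)).
Qed.

Section Whitney.
Variables (R : realType) (n : nat) (A : 'M[R]_(n, 4)).

(** Zaslavsky's theorem, by induction on [#|D|]. The subspace [U] must vary, because restriction
    replaces it by [U :&: hyp A i]. *)
Lemma realizable_count (U : 'M[R]_4) (D : {set 'I_n}) :
  (\sum_(P : {set 'I_n} | P \subset D) realizable A U D P)%:Z
  = (-1) ^+ \rank U *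
    \sum_(S : {set 'I_n} | S \subset D)
       (-1) ^+ #|S| * (-1) ^+ \rank (U :&: flat A S)%MS.
Proof.
have [m] := ubnP #|D|; elim: m U D => // m IH U D.
have [->|[i iD]] := set_0Vmem D.
  move=> _; rewrite (big_pred1 set0); last by move=> P; rewrite /= subset0.
  rewrite (big_pred1 set0); last by move=> P; rewrite /= subset0.
  rewrite cards0 expr0 mul1r flat0.
  have -> : \rank (U :&: fullspace R)%MS = \rank U.
    by rewrite (cap_eqmx (eqmx_refl U) (genmxE _)).1 capmx1.
  rewrite -exprMn mulrNN mulr1 expr1n.
  suff -> : realizable A U set0 set0 by [].
  by apply/asboolP; exists 0; [exact: sub0mx | move=> i; rewrite inE].
rewrite -(setD1K iD); set D' := D :\ i.
have iD' : i \notin D' by rewrite !inE eqxx.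
rewrite cardsU1 iD' add1n ltnS => Dm.
rewrite (@sum_subsets_setU1 nat) // (@sum_subsets_setU1 int) //.
have cardU1 (S : {set 'I_n}) : S \subset D' -> #|i |: S| = #|S|.+1.
  by move=> SD; rewrite cardsU1 (contra (subsetP SD i)).
(* If the form vanishes on [U], no sign at [i] is realizable, and on the right the terms of [S] and
   [i |: S] cancel. *)
have [Ui|Ui] := boolP (U <= hyp A i)%MS.
  rewrite big1 => [|P PD]; last first.
    have H Q : realizable A U (i |: D') Q = false.
      apply/asboolP => -[x xU /(_ i)]; rewrite setU11 => /(_ isT).
      have /eqP := submx_trans xU Ui; rewrite eqb_id sub_hyp_form => /eqP ->.
      by rewrite ltxx; case: ifP.
    by rewrite !H.
  rewrite [X in _ = _ * X]big1 ?mulr0 => [//|S SD].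
  rewrite (cardU1 _ SD) [X in _ + _ * (-1) ^+ X]rank_flatU1.
  have -> : \rank (U :&: hyp A i :&: flat A S)%MS = \rank (U :&: flat A S)%MS.
    exact: (cap_eqmx (capmx_idPl Ui) (eqmx_refl _)).1.
  by rewrite exprS mulN1r mulNr subrr.
rewrite (eq_bigr (fun P => realizable A U D' P
           + realizable A (U :&: hyp A i)%MS D' P)%N); last first.
  by move=> P PD; rewrite -realizable_split.
rewrite big_split /= PoszD IH // IH // (rank_cap_hyp Ui).
rewrite [in RHS]big_split mulrDr; congr (_ + _).
(* The rank drop from [U] to [U :&: hyp A i] costs one sign, which the extra element of [i |: S]
   restores. *)
rewrite exprS mulN1r mulNr -mulrN; congr (_ * _); rewrite -sumrN.
apply: eq_bigr => S SD.
rewrite (cardU1 _ SD) [X in _ = - (_ * (-1) ^+ X)]rank_flatU1.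
by rewrite exprS mulN1r mulNr opprK.
Qed.

End Whitney.

(** * Chambers *)

Section Chambers.
Variables (R : realType) (n : nat) (A : 'M[R]_(n, 4)).
Local Open Scope classical_set_scope.

Definition region (P : {set 'I_n}) : set 'rV[R]_4 := sign_on A [set: 'I_n]%SET P.

Lemma form_continuous (i : 'I_n) : continuous (form A i).
Proof.
have cont_sum (s : seq 'I_4) : continuous (fun x : 'rV[R]_4 => \sum_(j <- s) x 0 j * A i j).
  elim: s => [|j s IHs].
    rewrite (_ : (fun _ => _) = fun=> 0); first exact: cst_continuous.
    by apply/funext => x; rewrite big_nil.
  rewrite (_ : (fun _ => _) = fun x : 'rV[R]_4 => x 0 j * A i j + \sum_(j <- s) x 0 j * A i j).
    move=> x; apply: (@continuousD _ _ _ (fun x : 'rV[R]_4 => x 0 j * A i j)); last exact: IHs.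
    apply: (@continuousM _ _ (fun x : 'rV[R]_4 => x 0 j) (fun=> A i j)).
      exact: coord_continuous.
    exact: cst_continuous.
  by apply/funext => x; rewrite big_cons.
have -> : form A i = fun x : 'rV[R]_4 => \sum_j x 0 j * A i j; last exact: cont_sum.
by apply/funext => x; rewrite /form mxE; apply: eq_bigr => j _; rewrite !mxE.
Qed.

Lemma region_complement P : region P `<=` complement A.
Proof.
move=> x Px i; rewrite mul_row_form; have := Px i (in_setT i).
by case: ifP => _ lt0; rewrite ?(gt_eqF lt0) ?(lt_eqF lt0).
Qed.

(** A nonempty region is convex, hence a union of segments that all issue from one of its points. *)
Lemma region_connected P : connected (region P).
Proof.
have [[x Px]|/set0P/negP/negPn/eqP->] := pselect (region P !=set0); last exact: connected0.
pose seg (y : 'rV[R]_4) := (fun t : R => t *: (y - x) + x) @` `[0, 1].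
have segE : region P = \bigcup_(y in region P) seg y.
  apply/seteqP; split => [y Py|z [y Py [t]]].
    by exists y => //; exists 1; rewrite /= ?in_itv /= ?ler01 ?lexx // scale1r subrK.
  rewrite /= in_itv /= => /andP[t0 t1] <-.
  (* The endpoints are treated apart, since [sign_on_convex] asks for positive coefficients. *)
  have [->|tn0] := eqVneq t 0; first by rewrite scale0r add0r.
  have [->|tn1] := eqVneq t 1; first by rewrite scale1r subrK.
  have -> : t *: (y - x) + x = t *: y + (1 - t) *: x.
    by rewrite scalerBr scalerBl scale1r addrAC -addrA.
  by apply: sign_on_convex; rewrite ?subr_gt0 ?lt_neqAle ?t1 ?t0 ?tn1 1?eq_sym ?tn0.
rewrite segE; apply: bigcup_connected.
  by exists x => y _; exists 0; rewrite /= ?in_itv /= ?lexx ?ler01 // scale0r add0r.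
move=> y _; apply: connected_continuous_connected.
  exact/connected_intervalP/interval_is_interval.
apply: continuous_subspaceT => t; apply: cvgD; last exact: cvg_cst.
by apply: cvgZr_tmp; exact: cvg_id.
Qed.

(** The region is connected, so it lies in the component. Conversely, each form maps the component
    onto an interval avoiding 0, so its sign is constant there. *)
Lemma component_region P x : region P x ->
  connected_component (complement A) x = region P.
Proof.
move=> Px; have Cx := region_complement Px.
apply/seteqP; split; last first.
  apply: connected_component_max => //; [exact: region_complement|exact: region_connected].
move=> y Cy i _.
have itv : is_interval (form A i @` connected_component (complement A) x).
  apply/connected_intervalP/connected_continuous_connected.
    exact: component_connected.
  by apply: continuous_subspaceT; exact: form_continuous.
have n0 : ~ (form A i @` connected_component (complement A) x) 0.
  by case=> z /connected_component_sub /(_ i); rewrite mul_row_form => /eqP.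
have xin : (form A i @` connected_component (complement A) x) (form A i x).
  by exists x => //; exact: connected_component_refl.
have yin : (form A i @` connected_component (complement A) x) (form A i y).
  by exists y.
have yn0 : form A i y != 0.
  by have := connected_component_sub Cy i; rewrite mul_row_form.
have := Px i (in_setT i); case: ifP => _ fx.
  rewrite lt_neqAle eq_sym yn0 leNgt; apply/negP => fy.
  by apply: n0; apply: (itv (form A i y) (form A i x)) => //; rewrite (ltW fx) (ltW fy).
rewrite lt_neqAle yn0 leNgt; apply/negP => fy.
by apply: n0; apply: (itv (form A i x) (form A i y)) => //; rewrite (ltW fx) (ltW fy).
Qed.

Lemma region_inj P Q x : region P x -> region Q x -> P = Q.
Proof.
move=> Px Qx; apply/setP => i; have := Px i (in_setT i); have := Qx i (in_setT i).
by do 2 case: ifP => _; move=> // l1 l2; have := lt_trans l1 l2; rewrite ltxx.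
Qed.

(** Chambers are the nonempty regions, and a nonempty region determines its sign vector. *)
Lemma card_chambers :
  #|` fset_set (central_chambers A)| =
  (\sum_(P : {set 'I_n} | P \subset [set: 'I_n]%SET)
     realizable A (fullspace R) [set: 'I_n]%SET P)%N.
Proof.
pose good := [set P : {set 'I_n} | realizable A (fullspace R) [set: 'I_n]%SET P]%SET.
have goodP P : reflect (region P !=set0) (P \in good).
  rewrite inE; apply: (iffP (asboolP _)) => [[x _ Px]|[x Px]]; exists x => //.
  by rewrite genmxE submx1.
(* This also gives finiteness, without which [fset_set] would return its default, the empty set. *)
have -> : central_chambers A = region @` [set` good].
  apply/seteqP; split => [C [x Cx <-]|C [P /= /goodP[x Px] <-]].
    pose P := [set i | 0 < form A i x]%SET.
    have Px : region P x.
      move=> i _; rewrite inE; case: ltrgtP => // E.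
      by have := Cx i; rewrite mul_row_form E eqxx.
    by exists P; [apply/goodP; exists x | rewrite (component_region Px)].
  by exists x; [exact: region_complement Px | exact: component_region].
rewrite fset_set_image; last exact: finite_finset.
rewrite card_in_imfset /=; last first.
  move=> P Q; rewrite !in_fset_set ?inE; try exact: finite_finset.
  move=> /set_mem/goodP[x Px] _ E; have Qx : region Q x by rewrite -E.
  exact: region_inj Px Qx.
rewrite (_ : fset_set [set` good] = seq_fset tt (enum good)); last first.
  apply/fsetP => P; rewrite in_fset_set; last exact: finite_finset.
  rewrite seq_fsetE mem_enum; apply/idP/idP => [/set_mem//|PG]; exact: mem_set.
rewrite size_seq_fset undup_id ?enum_uniq // -cardE -sum1_card big_mkcond /=.
apply: eq_big => [P|P _]; first by rewrite subsetT.
by rewrite inE; case: (realizable _ _ _ _).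
Qed.

End Chambers.

(** * The characteristic polynomial *)

(** For a fixed element of [D], the subsets with and without it cancel in pairs. *)
Lemma alternating_sum_subsets (T : finType) (D : {set T}) : D != set0 ->
  \sum_(S : {set T} | S \subset D) (-1) ^+ #|S| = 0 :> int.
Proof.
case/set0Pn => i iD; rewrite -(setD1K iD) sum_subsets_setU1 ?setD11 // big1 // => S SD.
by rewrite cardsU1 (contra (subsetP SD i)) ?setD11 // exprS mulN1r subrr.
Qed.

Section CharacteristicPolynomial.
Variables (R : realType) (n : nat) (A : 'M[R]_(n, 4)).
Hypothesis arrA : is_arrangement A.
Implicit Types (S T : {set 'I_n}) (i j : 'I_n) (X Y : 'M[R]_4).

Lemma rank_fullspace : \rank (fullspace R) = 4%N.
Proof. by rewrite genmxE mxrank1. Qed.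

Lemma rank_flat S : \rank (flat A S) = (4 - \rank (formsOf A S))%N.
Proof. by rewrite genmxE mxrank_ker mxrank_tr. Qed.

Lemma row_sub_formsOf S i : i \in S -> (row i A <= formsOf A S)%MS.
Proof. by move=> iS; apply: (eq_row_sub i); rewrite rowK iS. Qed.

Lemma rank_hyp i : \rank (hyp A i) = 3%N.
Proof.
case: arrA => nz _ _.
rewrite rank_flat; suff -> : \rank (formsOf A [set i]) = 1%N by [].
rewrite -[RHS](_ : \rank (row i A) = 1%N); last by rewrite rank_rV nz.
apply: eqmx_rank; apply/andP; split; last by rewrite row_sub_formsOf ?set11.
apply/row_subP => j; rewrite rowK inE; case: eqP => [->//|_]; exact: sub0mx.
Qed.

(** If [hyp A i] lay in [hyp A j], the flat would have dimension 3, so the two forms would span a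
    single line, against distinctness. *)
Lemma rank_flat2 i j : i != j -> \rank (flat A [set i; j]) = 2%N.
Proof.
case: arrA => nz dist _ ij.
have E : \rank (flat A [set i; j]) = \rank (hyp A i :&: hyp A j)%MS.
  rewrite -[flat _ _]cap1mx setUC rank_flatU1 cap1mx capmxC //.
have [sub|nsub] := boolP (hyp A i <= hyp A j)%MS; last first.
  by have := rank_cap_hyp nsub; rewrite rank_hyp -E => -[].
have : \rank (flat A [set i; j]) = 3%N.
  by rewrite E (capmx_idPl sub) rank_hyp.
rewrite rank_flat => r3.
have r1 : \rank (formsOf A [set i; j]) = 1%N.
  have := rank_leq_col (formsOf A [set i; j]); lia.
have eqrow k : k \in [set i; j] -> <<row k A>>%MS = <<formsOf A [set i; j]>>%MS.
  move=> kS; apply/genmxP; rewrite -(mxrank_leqif_eq (row_sub_formsOf kS)).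
  by rewrite rank_rV nz r1.
by have := dist i j ij; rewrite !eqrow ?eqxx // !inE eqxx ?orbT.
Qed.

Lemma rank_flat_le2 S : (1 < #|S|)%N -> (\rank (flat A S) <= 2)%N.
Proof.
case/card_gt1P => i [j [iS jS ij]].
apply: (@leq_trans (\rank (flat A [set i; j]))); last by rewrite rank_flat2.
apply/mxrankS/flatS.
by rewrite subUset !sub1set iS jS.
Qed.

Lemma rank_flat_eq4 S : (\rank (flat A S) == 4%N) = (S == set0).
Proof.
have [->|/set0Pn[i iS]] := eqVneq S set0; first by rewrite flat0 rank_fullspace.
have : (\rank (flat A S) <= \rank (hyp A i))%N by apply/mxrankS/flatS; rewrite sub1set.
by rewrite rank_hyp; case: eqP => // ->.
Qed.

Lemma rank_flat_eq3 S : (\rank (flat A S) == 3%N) = (#|S| == 1%N).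
Proof.
have [S1|S1|/eqP/cards1P[i ->]] := ltngtP #|S| 1%N.
- have -> : S = set0 by apply/eqP; rewrite -cards_eq0; lia.
  by rewrite flat0 rank_fullspace.
- by have := rank_flat_le2 S1; case: eqP => // ->.
- by rewrite (rank_hyp i).
Qed.

(** * Whitney's formula for the Moebius function *)

Lemma ltmx_Lat X Y : X \in Lat A -> Y \in Lat A ->
  (X < Y)%MS = (X <= Y)%MS && (X != Y).
Proof.
rewrite !mem_Lat => /existsP[S /eqP->] /existsP[T /eqP->].
rewrite ltmxE; case: (boolP (_ <= _)%MS) => //= ST; congr (~~ _).
by apply/idP/eqP => [TS|->]; [exact: eq_flat | exact: submx_refl].
Qed.

(** Groups the sets of hyperplanes by the flat they cut out, to pass between sums over the lattice
    and sums over subsets. *)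
Lemma sum_Lat (V : nmodType) (Q : pred 'M[R]_4) (F : {set 'I_n} -> V) :
  \sum_(Y <- Lat A | Q Y) \sum_(S | flat A S == Y) F S = \sum_(S | Q (flat A S)) F S.
Proof.
rewrite (exchange_big_dep (fun S => Q (flat A S))) /=; last by move=> Y S QY /eqP->.
apply: eq_bigr => S QS; rewrite -big_filter.
have -> : [seq Y <- Lat A | Q Y && (flat A S == Y)] = [:: flat A S].
  rewrite -(filter_pred1_uniq (undup_uniq _) (flat_in_Lat A S)).
  apply: eq_filter => Y /=; rewrite eq_sym; case: eqP => [->|]; rewrite ?QS ?andbF //.
by rewrite big_seq1.
Qed.

Definition whitney X : int := \sum_(S : {set 'I_n} | flat A S == X) (-1) ^+ #|S|.

(** The sets in question are the subsets of the set of hyperplanes containing [X], which is nonempty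
    when [X] is not the whole space. *)
Lemma sum_flats_above X : X \in Lat A -> X != fullspace R ->
  \sum_(S : {set 'I_n} | (X <= flat A S)%MS) (-1) ^+ #|S| = 0 :> int.
Proof.
rewrite mem_Lat => /existsP[T /eqP->] XF.
rewrite (eq_bigl (fun S => S \subset [set i | (flat A T <= hyp A i)%MS])); last first.
  by move=> S; rewrite sub_flat_hyp.
apply: alternating_sum_subsets; apply: contraNneq XF => E.
have : T \subset [set i | (flat A T <= hyp A i)%MS] by rewrite -sub_flat_hyp.
by rewrite E subset0 => /eqP->; rewrite flat0.
Qed.

(** By [sum_flats_above], the Whitney sums obey the Moebius recursion. Each strict step up the
    subspaces raises the rank, so the fuel condition survives; it fails at fuel 0 because ranks are
    at most 4. *)
Lemma mob_recE k X : X \in Lat A -> (4 < k + \rank X)%N -> mob_rec A k X = whitney X.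
Proof.
elim: k X => [|k IH] X XL; first by rewrite add0n ltnNge rank_leq_row.
move=> kX /=; case: eqP => [->|/eqP XF].
  rewrite /whitney (big_pred1 set0) ?cards0 // => S /=.
  rewrite -rank_flat_eq4; apply/eqP/eqP => [->|r4]; first by rewrite rank_fullspace.
  by move/eqP: r4; rewrite rank_flat_eq4 => /eqP->; rewrite flat0.
apply/eqP; rewrite eq_sym -addr_eq0; apply/eqP.
rewrite -[RHS](sum_flats_above XL XF) -(sum_Lat (fun Y => (X <= Y)%MS)).
rewrite [RHS](bigID (pred1 X)) /=; congr (_ + _).
  rewrite -big_filter (_ : [seq Y <- _ | _] = [:: X]) ?big_seq1 //.
  rewrite -(filter_pred1_uniq (undup_uniq _) XL); apply: eq_filter => Y /=.
  by case: eqP => [->|]; rewrite ?submx_refl ?andbF.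
rewrite big_seq_cond [RHS]big_seq_cond; apply: eq_big => [Y|Y /andP[YL XY]].
  by case: (boolP (Y \in _)) => //= YL; rewrite ltmx_Lat // eq_sym.
by apply: IH => //; have := rank_ltmx XY; move: kX; lia.
Qed.

Lemma charpolyE :
  charpoly A = \sum_(S : {set 'I_n}) ((-1) ^+ #|S|)%:P * 'X^(\rank (flat A S)).
Proof.
rewrite /charpoly -[RHS](sum_Lat predT) big_seq [RHS]big_seq; apply: eq_bigr => X XL.
rewrite /mobius mob_recE // rmorph_sum /= mulr_suml; apply: eq_bigr => S /eqP->; by [].
Qed.

Lemma charpoly_coef k : (charpoly A)`_k =
  \sum_(S : {set 'I_n} | \rank (flat A S) == k) (-1) ^+ #|S|.
Proof.
rewrite charpolyE coef_sum [RHS]big_mkcond; apply: eq_bigr => S _.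
by rewrite coefCM coefXn eq_sym; case: eqP => _; rewrite ?mulr1 ?mulr0.
Qed.

(** * Values at 1 and -1, and the two leading coefficients *)

Lemma arrangement_gt0 : (0 < n)%N.
Proof. by case: arrA => _ _; case: n A => // B; rewrite flatmx0 mxrank0. Qed.

Lemma charpoly_at1 : (charpoly A).[1] = 0.
Proof.
rewrite charpolyE horner_sum -[RHS](@alternating_sum_subsets _ [set: 'I_n]).
  apply: eq_big => [S|S _]; first by rewrite subsetT.
  by rewrite !hornerE expr1n mulr1.
by rewrite -card_gt0 cardsT card_ord arrangement_gt0.
Qed.

(** At -1 the subset expansion is the count of sign vectors in the full space, whose sign factor
    (-1)^4 is 1. *)
Lemma charpoly_atN1 : (charpoly A).[-1] = #|` fset_set (central_chambers A)|%:Z.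
Proof.
rewrite card_chambers realizable_count rank_fullspace charpolyE horner_sum mul1r.
apply: eq_big => [S|S _]; first by rewrite subsetT.
rewrite !hornerE (_ : \rank (fullspace R :&: flat A S)%MS = \rank (flat A S)) //.
by rewrite (cap_eqmx (genmxE _) (eqmx_refl _)).1 cap1mx.
Qed.

Lemma charpoly_coef4 : (charpoly A)`_4 = 1.
Proof.
rewrite charpoly_coef (eq_bigl (pred1 set0)) => [|S]; first by rewrite big_pred1_eq cards0.
by rewrite rank_flat_eq4.
Qed.

Lemma sum_singletons (D : {set 'I_n}) :
  \sum_(S : {set 'I_n} | (S \subset D) && (#|S| == 1%N)) (-1) ^+ #|S| = - #|D|%:Z.
Proof.
rewrite (eq_bigr (fun=> -1)) => [|S /andP[_ /eqP->]//].
rewrite sumr_const mulNrn; congr (- _); rewrite pmulrn intz; congr Posz.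
rewrite -[RHS](card_imset _ set1_inj); apply: eq_card => S.
rewrite unfold_in /=; apply/andP/imsetP => [[SD /cards1P[i Ei]]|[i iD ->]].
  by exists i; rewrite // -sub1set -Ei.
by rewrite sub1set iD cards1.
Qed.

Lemma charpoly_coef3 : (charpoly A)`_3 = - n%:Z.
Proof.
rewrite charpoly_coef -[X in - X%:Z]card_ord -cardsT -sum_singletons.
by apply: eq_bigl => S; rewrite subsetT rank_flat_eq3.
Qed.

(** * Lines, their weights and the coefficient of t^2 *)

Lemma mem_lines X : X \in lines A -> exists2 T, X = flat A T & \rank X = 2%N.
Proof.
rewrite mem_filter mem_Lat => /andP[/eqP r2 /existsP[T /eqP E]]; by exists T.
Qed.

Lemma weight_gt1 X : X \in lines A -> (1 < weight A X)%N.
Proof.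
case/mem_lines => T -> r2.
have TW : T \subset [set i | (flat A T <= hyp A i)%MS] by rewrite -sub_flat_hyp.
apply: leq_trans (subset_leq_card TW); rewrite ltnNge; apply/negP => T1.
have [T0|T0] := posnP #|T|.
  by move/eqP: T0; rewrite cards_eq0 -rank_flat_eq4 r2.
have : #|T| == 1%N by lia.
by rewrite -rank_flat_eq3 r2.
Qed.

(** Over the subsets of the w hyperplanes through [X] the alternating sum is 0. The empty set
    contributes 1 and the singletons -w; every other subset cuts out exactly [X]. *)
Lemma whitney_line X : X \in lines A -> whitney X = (weight A X).-1%:Z.
Proof.
move=> Xl; have := weight_gt1 Xl; have [T XT r2] := mem_lines Xl.
have XL : X \in Lat A by rewrite XT flat_in_Lat.
have XF : X != fullspace R.
  by apply/eqP => E; move: r2; rewrite E rank_fullspace.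
have := sum_flats_above XL XF.
rewrite (bigID (fun S => \rank (flat A S) == 4%N)) /=.
rewrite (big_pred1 set0) => [|S]; last first.
  rewrite /= rank_flat_eq4; case: eqP => [->|]; rewrite ?andbF // andbT.
  by rewrite sub_flat_hyp sub0set.
rewrite cards0 (bigID (fun S => #|S| == 1%N)) /=.
rewrite (eq_bigl (fun S => (S \subset [set i | (X <= hyp A i)%MS]) && (#|S| == 1%N))); last first.
  move=> S; rewrite -sub_flat_hyp rank_flat_eq4 -andbA; congr (_ && _).
  by rewrite -cards_eq0; case: eqP => [->|]; rewrite ?andbF.
rewrite sum_singletons -/(weight A X).
rewrite (eq_bigl (fun S => flat A S == X)) -/(whitney X); last first.
  move=> S; rewrite rank_flat_eq4 -andbA; apply/and3P/eqP => [[XS S0 S1]|SX].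
    rewrite XT; apply: eq_flat; rewrite -XT //.
    have [_] := mxrank_leqif_sup XS; case: eqP => [_ <-//|] ; case.
    have : (1 < #|S|)%N by rewrite -cards_eq0 in S0; move: S0 S1; case: #|S| => [|[]].
    by move=> /rank_flat_le2; have := mxrankS XS; rewrite r2; lia.
  split; first by rewrite SX submx_refl.
    by rewrite -rank_flat_eq4 SX r2.
  by rewrite -rank_flat_eq3 SX r2.
lia.
Qed.

(** Sorts the lines by weight; all weights lie between 2 and n, so the range of summation loses
    none. *)
Lemma sum_hcount (F : nat -> nat) :
  (\sum_(2 <= k < n.+1) F k * hcount A k)%N = (\sum_(X <- lines A) F (weight A X))%N.
Proof.
under eq_bigr => k _ do rewrite /hcount -sum1_count big_distrr /= big_mkcond /=.
rewrite exchange_big /= big_seq [RHS]big_seq; apply: eq_bigr => X Xl.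
have wX : weight A X \in index_iota 2 n.+1.
  rewrite mem_index_iota weight_gt1 //= ltnS -[X in (_ <= X)%N]card_ord.
  exact: max_card.
rewrite (bigD1_seq (weight A X) wX (iota_uniq _ _)) /=.
rewrite eqxx muln1 big1 ?addn0 // => k kX.
by rewrite eq_sym (negPf kX).
Qed.

Lemma hsumE : hsum A = (\sum_(X <- lines A) (weight A X).-1)%N.
Proof. exact: sum_hcount. Qed.

(** Double counting of incidences between lines and hyperplanes: the restriction sizes add up to the
    sum of all weights, and [g1] removes 1 for each line. *)
Lemma hsum_restr_size : (hsum A)%:Z = (\sum_(i < n) restr_size A i)%:Z - (g1 A)%:Z.
Proof.
have -> : g1 A = (\sum_(X <- lines A) 1)%N.
  by rewrite -(sum_hcount (fun=> 1%N)); apply: eq_bigr => k _; rewrite mul1n.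
have -> : (\sum_(i < n) restr_size A i = \sum_(X <- lines A) weight A X)%N.
  rewrite (eq_bigr (fun i => \sum_(X <- lines A | (X <= hyp A i)%MS) 1)%N); last first.
    by move=> i _; rewrite sum1_count.
  rewrite (exchange_big_dep predT) //=; apply: eq_bigr => X _.
  by rewrite sum1dep_card.
apply/eqP; rewrite eq_sym subr_eq -PoszD hsumE -big_split /=; apply/eqP; congr Posz.
by rewrite big_seq [RHS]big_seq; apply: eq_bigr => X /weight_gt1; lia.
Qed.

Lemma charpoly_coef2 : (charpoly A)`_2 = (hsum A)%:Z.
Proof.
rewrite charpoly_coef -(sum_Lat (fun X => \rank X == 2%N)) hsumE.
rewrite (big_morph Posz PoszD (erefl _)) /lines big_filter.
rewrite big_seq_cond [RHS]big_seq_cond; apply: eq_bigr => X /andP[XL r2].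
by apply: whitney_line; rewrite mem_filter r2.
Qed.
End CharacteristicPolynomial.

Lemma charpoly_formula (R : realType) (n : nat) (A : 'M[R]_(n, 4)) :
  is_arrangement A ->
  charpoly A = ('X - 1) * ('X^3 + (1 - n%:Z)%:P * 'X^2
    + ((hsum A)%:Z + 1 - n%:Z)%:P * 'X + ((hsum A)%:Z + 1 - (f3 A)%:Z)%:P).
Proof.
move=> arrA; set h := hsum A.
have chiE : charpoly A = \poly_(k < 5) (charpoly A)`_k.
  apply/polyP => k; rewrite coef_poly; case: ltnP => // k5.
  rewrite charpoly_coef // big_pred0 // => S; apply/eqP => E.
  by have := rank_leq_row (flat A S); rewrite E leqNgt k5.
have c4 := charpoly_coef4 arrA; have c3 := charpoly_coef3 arrA.
have c2 := charpoly_coef2 arrA; have e1 := charpoly_at1 arrA.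
have eN1 := charpoly_atN1 arrA; move: e1 eN1; rewrite /f3.
set N := #|` _|; rewrite chiE !horner_poly !big_ord_recr !big_ord0 /= c4 c3 c2 -/h.
set c0 := _`_0; set c1 := _`_1 => e1 eN1.
have {}e1 : c0 + c1 + h%:Z - n%:Z + 1 = 0 by rewrite -[RHS]e1; ring.
have {}eN1 : c0 - c1 + h%:Z + n%:Z + 1 = N%:Z by rewrite -[RHS]eN1; ring.
(* Adding [e1] and [eN1] shows that [N] is even, so the integer division in [f3] is exact. *)
have f2 : N%:Z = (N %/ 2)%:Z * 2 by lia.
apply/polyP => k; rewrite mulrBl mul1r coefB coefXM.
rewrite !(coefD, coefXn, coefCM, coefX, coefC, coef_poly).
by case: k => [|[|[|[|[|k]]]]] //=; rewrite ?c4 ?c3 ?c2 -?/h -?/c0 -?/c1; lia.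
Qed.

(** * Real roots of cubics *)

(** With [a], [b], [c] the Vieta coefficients of the roots, both sides are 27 times the
    discriminant. *)
Lemma cubic_discriminant (F : comNzRingType) (x y z : F) :
  let a := - (x + y + z) in let b := x * y + x * z + y * z in
  let c := - (x * y * z) in
  4 * (a ^+ 2 - 3 * b) ^+ 3 - (2 * a ^+ 3 - 9 * a * b + 27 * c) ^+ 2
  = 27 * ((x - y) * (x - z) * (y - z)) ^+ 2.
Proof. by move=> a b c; rewrite /a /b /c; ring. Qed.

Lemma expand_cubic (F : comNzRingType) (x y z : F) :
  ('X - x%:P) * (('X - y%:P) * ('X - z%:P))
  = 'X^3 + (- (x + y + z))%:P * 'X^2 + (x * y + x * z + y * z)%:P * 'X
    + (- (x * y * z))%:P.
Proof. by rewrite !(polyCN, polyCD, polyCM); ring. Qed.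

(** The factors with [z] multiply to a squared modulus, and the difference of [x] and its conjugate
    is purely imaginary. *)
Lemma conj_pair_discriminant (x z : algC) : x \isn't Num.real -> z \is Num.real ->
  ((x - x^*) * (x - z) * (x^* - z)) ^+ 2 < 0.
Proof.
move=> xr zr.
have -> : x^* - z = (x - z)^* by rewrite rmorphB /= (CrealP zr).
rewrite -mulrA -normCK exprMn pmulr_llt0; last first.
  rewrite !exprn_gt0 // normr_gt0 subr_eq0; apply: contraNneq xr => ->.
  exact: zr.
have -> : (x - x^*) ^+ 2 = - `|x - x^*| ^+ 2.
  by rewrite normCK rmorphB /= conjCK expr2 -mulrN opprB.
rewrite oppr_lt0 exprn_gt0 // normr_gt0 subr_eq0 eq_sym.
by apply: contraNneq xr => /CrealP.
Qed.

(** Three real roots make the discriminant a real square. A non-real root comes with its conjugate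
    and a real third root, which makes it negative. *)
Lemma real_cubicP (a b c : int) (p : {poly algC}) :
  p = 'X^3 + (a%:~R)%:P * 'X^2 + (b%:~R)%:P * 'X + (c%:~R)%:P ->
  (forall z, root p z -> z \is Num.real) <->
  (2 * a ^+ 3 - 9 * a * b + 27 * c) ^+ 2 <= 4 * (a ^+ 2 - 3 * b) ^+ 3.
Proof.
move=> pE.
have sp : size p = 4%N.
  rewrite pE -!addrA size_polyDl size_polyXn // ltnS; apply/leq_sizeP => k.
  by case: k => [|[|[|k]]] // _; rewrite !(coefD, coefXn, coefCM, coefX, coefC) /= !mulr0 !addr0.
have lp : lead_coef p = 1.
  by rewrite lead_coefE sp pE !(coefD, coefXn, coefCM, coefX, coefC) /= !mulr0 !addr0.
have [r] := closed_field_poly_normal p; rewrite lp scale1r => pr.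
have : size r = 3%N by move: sp; rewrite pr size_prod_XsubC => -[].
case: r pr => [|x [|y [|z []]]] // pr _.
rewrite !big_cons big_nil mulr1 in pr.
have rp t : root p t = (t \in [:: x; y; z]).
  by rewrite pr !rootM !root_XsubC !inE.
have E := expand_cubic x y z; rewrite -pr pE in E.
have Ea : a%:~R = - (x + y + z).
  have /polyP/(_ 2%N) := E.
  by rewrite !(coefD, coefXn, coefCM, coefX, coefC) /= !mulr0 !addr0 !add0r !mulr1.
have Eb : b%:~R = x * y + x * z + y * z.
  have /polyP/(_ 1%N) := E.
  by rewrite !(coefD, coefXn, coefCM, coefX, coefC) /= !mulr0 !addr0 !add0r !mulr1.
have Ec : c%:~R = - (x * y * z).
  by have /polyP/(_ 0%N) := E; rewrite !(coefD, coefXn, coefCM, coefX, coefC) /= !mulr0 !add0r.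
rewrite -(ler_int algC) -subr_ge0 !(rmorphB, rmorphD, rmorphM, rmorphXn) /= Ea Eb Ec.
rewrite cubic_discriminant pmulr_rge0 ?ltr0n //.
split=> [H|].
  apply: real_exprn_even_ge0 => //.
  by rewrite !(realM, realB) // H // rp !inE eqxx ?orbT.
move=> disc_ge0 t rt; apply: contraLR disc_ge0 => tr.
have rt' : root p t^*.
  have -> : p = map_poly (@Num.conj algC) p.
    rewrite pE !(rmorphD, rmorphM, rmorphXn) /= !map_polyC /= !map_polyX.
    by rewrite !rmorph_int.
  by rewrite fmorph_root.
have tt' : t^* != t by apply: contraNneq tr => /CrealP.
(* The discriminant is symmetric in the roots, so they may be listed as [t], its conjugate and the
   rest of the root sum. *)
have xyz_sym : (((x - y) * (x - z) * (y - z)) ^+ 2 =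
   ((t - t^*) * (t - (x + y + z - t - t^*)) * (t^* - (x + y + z - t - t^*))) ^+ 2).
  move: rt rt' tt'; rewrite !rp !inE.
  by case/or3P => /eqP -> /or3P[] /eqP ->; rewrite ?eqxx // => _; ring.
rewrite xyz_sym lt_geF //; apply: conj_pair_discriminant => //.
(* The third root is real: the root sum is an integer and the conjugate pair has a real sum. *)
have -> : x + y + z = (- a)%:~R by rewrite rmorphN /= Ea opprK.
apply/CrealP; rewrite !rmorphB /= conjCK [in LHS]addrAC; congr (_ - _ - _).
by rewrite rmorph_int.
Qed.

(** Comparing an integer with a floor or a ceiling is comparing it with the real number itself. The
    first bound then says [0 <= D0], the other two that [D1] has absolute value at most [2 * s]. *)
Lemma bounds_discriminant (R : realType) (n h f : nat) :
  let nR : R := n%:R in let hR : R := h%:R in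
  let a := 1 - n%:Z in let b := h%:Z + 1 - n%:Z in let c := h%:Z + 1 - f%:Z in
  [/\ h%:Z <= Num.floor ((nR + 2) * (nR - 1) / 3),
      f%:Z <= Num.floor (((9 * nR + 18) * hR + 20 + 12 * nR
                   + 2 * Num.sqrt ((nR ^+ 2 + nR - 2 - 3 * hR) ^+ 3)
                   - 2 * nR ^+ 3 - 3 * nR ^+ 2) / 27)
    & Num.ceil (((9 * nR + 18) * hR + 20 + 12 * nR
                   - 2 * Num.sqrt ((nR ^+ 2 + nR - 2 - 3 * hR) ^+ 3)
                   - 2 * nR ^+ 3 - 3 * nR ^+ 2) / 27) <= f%:Z]
  <-> (2 * a ^+ 3 - 9 * a * b + 27 * c) ^+ 2 <= 4 * (a ^+ 2 - 3 * b) ^+ 3.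
Proof.
move=> nR hR a b c.
rewrite !floor_ge_int ceil_le_int -(ler_int R) /a /b /c.
rewrite !(rmorphB, rmorphD, rmorphM, rmorphXn) /= -!pmulrn -/nR -/hR.
set fR : R := f%:R; set D0 := nR ^+ 2 + nR - 2 - 3 * hR.
have -> : (1 - nR) ^+ 2 - 3 * (hR + 1 - nR) = D0 by rewrite /D0; ring.
set D1 := (9 * nR + 18) * hR + 20 + 12 * nR - 2 * nR ^+ 3 - 3 * nR ^+ 2 - 27 * fR.
have -> : 2 * (1 - nR) ^+ 3 - 9 * (1 - nR) * (hR + 1 - nR) + 27 * (hR + 1 - fR) = D1.
  by rewrite /D1; ring.
set s := Num.sqrt _.
have s0 : 0 <= s by exact: sqrtr_ge0.
have -> : (hR <= (nR + 2) * (nR - 1) / 3) = (0 <= D0).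
  by rewrite /D0; apply/idP/idP; lra.
rewrite ler_pdivlMr ?ler_pdivrMr ?ltr0n //.
have D03 : (0 <= D0 ^+ 3) = (0 <= D0) by rewrite exprn_odd_ge0.
have normD1 : s ^+ 2 = D0 ^+ 3 -> (D1 ^+ 2 <= 4 * D0 ^+ 3) = (`|D1| <= 2 * s).
  move=> <-; rewrite -[RHS](@ler_pXn2r _ 2) ?nnegrE ?mulr_ge0 //.
  by rewrite real_normK ?num_real // exprMn -natrX.
split=> [[D0_ge0 le1 le2]|D1D0].
  have s2 : s ^+ 2 = D0 ^+ 3 by rewrite sqr_sqrtr ?D03.
  rewrite normD1 // ler_norml /D1; apply/andP; split; lra.
(* [Num.sqrt] is 0 on negative reals, so the sign of [D0] must be settled before squaring; it
   follows since [D1 ^+ 2] is nonnegative and the cube preserves signs. *)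
have D0_ge0 : 0 <= D0.
  by rewrite -D03; have := sqr_ge0 D1; lra.
have s2 : s ^+ 2 = D0 ^+ 3 by rewrite sqr_sqrtr ?D03.
by move: D1D0; rewrite normD1 // ler_norml /D1 => /andP[l1 l2]; split; lra.
Qed.

(** Here the radicand vanishes, so the upper and lower bounds coincide, and the values 18/3 and
    216/27 are integers. *)
Lemma tight_bounds (R : realType) :
  let nR : R := 4%:R in let hR : R := 6%:R in
  [/\ 6%:Z = Num.floor ((nR + 2) * (nR - 1) / 3),
      8%:Z = Num.floor (((9 * nR + 18) * hR + 20 + 12 * nR
                   + 2 * Num.sqrt ((nR ^+ 2 + nR - 2 - 3 * hR) ^+ 3)
                   - 2 * nR ^+ 3 - 3 * nR ^+ 2) / 27)
    & 8%:Z = Num.ceil (((9 * nR + 18) * hR + 20 + 12 * nR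
                   - 2 * Num.sqrt ((nR ^+ 2 + nR - 2 - 3 * hR) ^+ 3)
                   - 2 * nR ^+ 3 - 3 * nR ^+ 2) / 27)].
Proof.
move=> nR hR.
have -> : (nR + 2) * (nR - 1) / 3 = 6%:~R by rewrite /nR; field.
have -> : nR ^+ 2 + nR - 2 - 3 * hR = 0 by rewrite /nR /hR; ring.
rewrite expr0n /= sqrtr0 mulr0 addr0 subr0.
have -> : ((9 * nR + 18) * hR + 20 + 12 * nR - 2 * nR ^+ 3 - 3 * nR ^+ 2) / 27 = 8%:~R.
  by rewrite /nR /hR; field.
by rewrite !intrKfloor intrKceil.
Qed.

Lemma real_roots_XsubC1M (q : {poly int}) :
  (forall z : algC, root (map_poly (fun c : int => c%:~R : algC) (('X - 1) * q)) z ->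
     z \is Num.real) <->
  (forall z : algC, root (map_poly (fun c : int => c%:~R : algC) q) z -> z \is Num.real).
Proof.
have E : map_poly (fun c : int => c%:~R : algC) (('X - 1) * q)
    = ('X - 1%:P) * map_poly (fun c : int => c%:~R : algC) q.
  by rewrite rmorphM /= rmorphB /= map_polyX rmorph1.
rewrite E; split=> H z rz; first by apply: H; rewrite rootM rz orbT.
by move: rz; rewrite rootM root_XsubC => /orP[/eqP->|/H//]; exact: real1.
Qed.

(** * The coordinate arrangement *)

Section Boolean.
Variable R : realType.
Let I4 : 'M[R]_4 := 1%:M.

Lemma form_boolean (i : 'I_4) (x : 'rV[R]_4) : form I4 i x = x 0 i.
Proof.
by rewrite /form /I4 rowE mulmx1 trmx_delta -colE mxE.
Qed.

Lemma boolean_arrangement : is_arrangement I4.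
Proof.
split; last by rewrite mxrank1.
- move=> i; apply/eqP => /matrixP/(_ 0 i); rewrite !mxE eqxx /= => /eqP.
  by rewrite oner_eq0.
- move=> i j ij; apply/eqP => /genmxP/andP[/sub_rVP[k] E _].
  have /matrixP/(_ 0 i) := E; rewrite !mxE eqxx eq_sym (negPf ij) /= mulr0 => /eqP.
  by rewrite oner_eq0.
Qed.

(** Each further coordinate hyperplane lowers the dimension by one: for [i] outside [T], the basis
    vector [delta_mx 0 i] lies in the flat of [T] but not in the [i]-th hyperplane. *)
Lemma rank_flat_boolean (S : {set 'I_4}) : (\rank (flat I4 S) + #|S| = 4)%N.
Proof.
have [m] := ubnP #|S|; elim: m S => // m IH S.
have [->|[i iS]] := set_0Vmem S; first by rewrite cards0 flat0 rank_fullspace.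
rewrite -(setD1K iS); set T := S :\ i; have iT : i \notin T by rewrite !inE eqxx.
rewrite cardsU1 iT add1n ltnS => Tm; rewrite -[RHS](IH T Tm) addnS -addSn; congr (_ + _)%N.
rewrite -[flat I4 (i |: T)]cap1mx rank_flatU1 cap1mx capmxC; apply/esym/rank_cap_hyp.
apply/negP => /(submx_trans _) sub.
have : ((delta_mx 0 i : 'rV[R]_4) <= flat I4 T)%MS.
  apply/sub_flatP => j jT; apply/eqP; rewrite mul_row_form form_boolean mxE eqxx.
  by rewrite (_ : (j == i) = false) //; apply: contraNF iT => /eqP<-.
by move=> /sub; rewrite sub_hyp_form form_boolean mxE !eqxx oner_eq0.
Qed.

(** Read off as the coefficient of t^2: the sets with a flat of dimension 2 are the 6 pairs, each
    counted with sign +1. *)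
Lemma boolean_hsum : hsum I4 = 6%N.
Proof.
apply/eqP; rewrite -eqz_nat -(charpoly_coef2 boolean_arrangement).
rewrite charpoly_coef; last exact: boolean_arrangement.
rewrite (eq_bigl (fun S : {set 'I_4} => #|S| == 2%N)); last first.
  by move=> S; have := rank_flat_boolean S; lia.
rewrite (eq_bigr (fun=> 1)) => [|S /eqP->//].
by rewrite sumr_const -cardsE card_draws card_ord.
Qed.

(** All 16 sign vectors are realized, by vectors with entries 1 and -1, and antipodes are
    identified. *)
Lemma boolean_chambers : f3 I4 = 8%N.
Proof.
rewrite /f3 card_chambers (eq_bigr (fun=> 1%N)) => [|P _].
  by rewrite sum1dep_card -/(powerset [set: 'I_4]) card_powerset cardsT card_ord.
suff -> : realizable I4 (fullspace R) setT P by [].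
apply/asboolP; exists (\row_(i < 4) (if i \in P then 1 else -1)).
  by rewrite genmxE submx1.
by move=> i _; rewrite form_boolean mxE; case: (i \in P); rewrite ?oppr_lt0 ltr01.
Qed.

End Boolean.

(** * The formula, the criterion for real roots and the sharpness of the bounds *)

Theorem theorem1 (R : realType) :
  (forall (n : nat) (A : 'M[R]_(n, 4)), is_arrangement A ->
    let h : nat := hsum A in
    let f : nat := f3 A in
    let nR : R := n%:R in
    let hR : R := h%:R in
    (* (i) *)
    charpoly A = ('X - 1) * ('X^3 + (1 - n%:Z)%:P * 'X^2
                   + (h%:Z + 1 - n%:Z)%:P * 'X + (h%:Z + 1 - f%:Z)%:P)
    /\
    (* (ii) *)
    ((forall z : algC,
        root (map_poly (fun c : int => c%:~R : algC) (charpoly A)) z ->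
        z \is Num.real)
     <->
     [/\ (* (1) *)
         h%:Z = (\sum_(i < n) restr_size A i)%:Z - (g1 A)%:Z
         /\ h%:Z <= Num.floor ((nR + 2) * (nR - 1) / 3),
         (* (2) *)
         f%:Z <= Num.floor (((9 * nR + 18) * hR + 20 + 12 * nR
                   + 2 * Num.sqrt ((nR ^+ 2 + nR - 2 - 3 * hR) ^+ 3)
                   - 2 * nR ^+ 3 - 3 * nR ^+ 2) / 27)
       & (* (3) *)
         Num.ceil (((9 * nR + 18) * hR + 20 + 12 * nR
                   - 2 * Num.sqrt ((nR ^+ 2 + nR - 2 - 3 * hR) ^+ 3)
                   - 2 * nR ^+ 3 - 3 * nR ^+ 2) / 27) <= f%:Z]))
  /\
  (* tightness: one arrangement attaining equality in (1), (2) and (3) *)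
  (exists (n : nat) (A : 'M[R]_(n, 4)), is_arrangement A /\
    let h : nat := hsum A in
    let f : nat := f3 A in
    let nR : R := n%:R in
    let hR : R := h%:R in
    [/\ h%:Z = Num.floor ((nR + 2) * (nR - 1) / 3),
        f%:Z = Num.floor (((9 * nR + 18) * hR + 20 + 12 * nR
                   + 2 * Num.sqrt ((nR ^+ 2 + nR - 2 - 3 * hR) ^+ 3)
                   - 2 * nR ^+ 3 - 3 * nR ^+ 2) / 27)
      & f%:Z = Num.ceil (((9 * nR + 18) * hR + 20 + 12 * nR
                   - 2 * Num.sqrt ((nR ^+ 2 + nR - 2 - 3 * hR) ^+ 3)
                   - 2 * nR ^+ 3 - 3 * nR ^+ 2) / 27)]).

Proof.
split=> [n A arrA h f nR hR|].
  have chiE := charpoly_formula arrA; rewrite -/h -/f in chiE.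
  split=> //; rewrite chiE.
  have realE := real_roots_XsubC1M ('X^3 + (1 - n%:Z)%:P * 'X^2
    + (h%:Z + 1 - n%:Z)%:P * 'X + (h%:Z + 1 - f%:Z)%:P).
  have cubicE := @real_cubicP (1 - n%:Z) (h%:Z + 1 - n%:Z) (h%:Z + 1 - f%:Z) _ (erefl _).
  have mapE : map_poly (fun c : int => c%:~R : algC) ('X^3 + (1 - n%:Z)%:P * 'X^2
      + (h%:Z + 1 - n%:Z)%:P * 'X + (h%:Z + 1 - f%:Z)%:P)
    = 'X^3 + ((1 - n%:Z)%:~R)%:P * 'X^2 + ((h%:Z + 1 - n%:Z)%:~R)%:P * 'X
      + ((h%:Z + 1 - f%:Z)%:~R)%:P.
    by rewrite !(rmorphD, rmorphM, rmorphXn) /= !map_polyX !map_polyC.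
  rewrite mapE in realE; have boundE := bounds_discriminant R n h f.
  split=> [/realE/cubicE/boundE[le1 le2 le3]|[[_ le1] le2 le3]].
    (* The equality in (1) is the double count of incidences; the three inequalities come from the
       discriminant. *)
    by split=> //; split=> //; exact: hsum_restr_size.
  by apply/realE/cubicE/boundE; split.
exists 4%N, 1%:M; split; first exact: boolean_arrangement.
by rewrite boolean_hsum boolean_chambers; exact: tight_bounds.
Qed.
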